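(* Let $X$ be a nonempty two-sided shift space over a finite alphabet with $h_F(X) = 0$ and $h_P(X) > 0$. Then $(X,\sigma)$ is not conjugate to its inverse $(X,\sigma^{-1})$.
   Context: A two-sided shift space over a finite alphabet $A$ is a subset $X \subset A^{\mathbb{Z}}$ which is closed (product topology) and invariant under the left shift $\sigma$, $(\sigma x)(n) = x(n+1)$. Two topological dynamical systems $(X,T)$ and $(Y,S)$ (compact metric spaces with continuous self-maps) are conjugate if there is a continuous bijection $\varphi: X\to Y$ with $S\circ\varphi = \varphi\circ T$. The language $L(X)$ is the set of all finite words appearing in points of $X$, and $L_n(X)$ is the set of words of length $n$ in $L(X)$. For $w \in L(X)$, the follower set $F_X(w)$ is the set of all words $u \in L(X)$ such that $wu$ occurs in some point of $X$, and the predecessor set $P_X(w)$ is the set of all words $s \in L(X)$ such that $sw$ occurs in some point of $X$. Set $F_X(n) = \{F_X(w) : w \in L_n(X)\}$ and $P_X(n) = \{P_X(w): w\in L_n(X)\}$. The follower entropy is $h_F(X) = \limsup_{n\to\infty}\frac{1}{n}\log|F_X(n)|$ and the predecessor entropy is $h_P(X) = \limsup_{n\to\infty}\frac{1}{n}\log|P_X(n)|$. *)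

(* Defs.v *)
From HB Require Import structures.
From mathcomp Require Import all_boot all_order all_algebra.
From mathcomp Require Import finmap.
From mathcomp Require Import all_classical all_reals all_analysis.

Set Implicit Arguments.
Unset Strict Implicit.
Unset Printing Implicit Defensive.

Import Order.TTheory GRing.Theory Num.Theory.

Local Open Scope classical_set_scope.
Local Open Scope ring_scope.

(* Product topology on A^Z, with A discrete. *)
Notation full_shift A := {ptws int -> discrete_topology A}.

Definition shift_map (A : finType) (x : full_shift A) : full_shift A :=
  fun n => x (n + 1).

Definition shift_map_inv (A : finType) (x : full_shift A) : full_shift A :=
  fun n => x (n - 1).

(* Invariance is the equality sigma(X) = X, so that sigma^-1 also acts on X. *)
Definition shift_space (A : finType) (X : set (full_shift A)) : Prop :=
  closed X /\ @shift_map A @` X = X.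

(* Conjugacy of the systems (X, f) and (Y, g), where X and Y carry the topology
   induced from T and U. The values of phi outside X are irrelevant. *)
Definition topologically_conjugate (T U : topologicalType)
    (X : set T) (f : T -> T) (Y : set U) (g : U -> U) : Prop :=
  exists phi : T -> U,
    [/\ {within X, continuous phi}, set_bij X Y phi &
        forall x, X x -> g (phi x) = phi (f x)].

(* The word x(i) x(i+1) ... x(i+n-1). *)
Definition subword (A : finType) (x : full_shift A) (i : int) (n : nat) : seq A :=
  mkseq (fun k => x (i + k%:Z)) n.

Definition language (A : finType) (X : set (full_shift A)) : set (seq A) :=
  [set w | exists2 x, X x & exists i, subword x i (size w) = w].

Definition language_n (A : finType) (X : set (full_shift A)) (n : nat) :
    set (seq A) :=
  [set w | language X w /\ size w = n].

Definition follower_set (A : finType) (X : set (full_shift A)) (w : seq A) :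
    set (seq A) :=
  [set u | language X u /\ language X (w ++ u)].

Definition predecessor_set (A : finType) (X : set (full_shift A)) (w : seq A) :
    set (seq A) :=
  [set s | language X s /\ language X (s ++ w)].

Definition follower_sets (A : finType) (X : set (full_shift A)) (n : nat) :
    set (set (seq A)) :=
  follower_set X @` language_n X n.

Definition predecessor_sets (A : finType) (X : set (full_shift A)) (n : nat) :
    set (set (seq A)) :=
  predecessor_set X @` language_n X n.

Lemma finite_language_n (A : finType) (X : set (full_shift A)) (n : nat) :
  finite_set (language_n X n).
Proof.
apply: (@sub_finite_set _ _ (@tval n A @` setT)).
  by move=> w [_ sw]; exists (tcast sw (in_tuple w)) => //; rewrite val_tcast.
exact/finite_image/finite_finset.
Qed.

(* fset_set is the empty set on infinite sets; these two lemmas show that the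
   cardinals in the entropies below are the genuine ones. *)
Lemma finite_follower_sets (A : finType) (X : set (full_shift A)) (n : nat) :
  finite_set (follower_sets X n).
Proof. exact/finite_image/finite_language_n. Qed.

Lemma finite_predecessor_sets (A : finType) (X : set (full_shift A)) (n : nat) :
  finite_set (predecessor_sets X n).
Proof. exact/finite_image/finite_language_n. Qed.

Definition follower_entropy (R : realType) (A : finType)
    (X : set (full_shift A)) : \bar R :=
  limn_esup (fun n => (n%:R^-1 * ln (#|` fset_set (follower_sets X n)|%:R))%:E).

Definition predecessor_entropy (R : realType) (A : finType)
    (X : set (full_shift A)) : \bar R :=
  limn_esup
    (fun n => (n%:R^-1 * ln (#|` fset_set (predecessor_sets X n)|%:R))%:E).

(* Main.v *)
Require Import Defs.
From mathcomp Require Import all_boot all_order all_algebra.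
From mathcomp Require Import finmap zify lra.
From mathcomp Require Import all_classical all_reals all_analysis.

(** Let phi conjugate the shift on X to its inverse. By compactness phi and its
    inverse are block codes of some radius r, up to reversing the coordinates:
    phi(x)(k) depends only on x on [- k - r, - k + r], and conversely. Hence the
    predecessor set of a word v of length n is determined by the pairs
    (last 2r letters of p, follower set of p), where p ranges over the words of
    length n + 2r that phi sends to v. Such a p is determined by v except for 2r
    letters at each end, so the number of pairs is bounded independently of n,
    and |P_X(n)| <= (C |F_X(n + 2r)|)^K with C and K independent of n. Zero
    follower entropy therefore forces zero predecessor entropy. *)

Set Implicit Arguments.
Unset Strict Implicit.
Unset Printing Implicit Defensive.

Import Order.TTheory GRing.Theory Num.Theory.

Local Open Scope classical_set_scope.
Local Open Scope ring_scope.

Definition agree (A : Type) (a b : int) (x z : int -> A) : Prop :=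
  forall k : int, a <= k <= b -> x k = z k.

(** * Compactness and uniform local rules *)

Section Topology.
Variable A : finType.
Implicit Types (x z c : full_shift A) (X : set (full_shift A)) (r : nat).

Lemma near_coord c (k : int) : \forall z \near c, z k = c k.
Proof.
have := @proj_continuous int (fun=> discrete_topology A) k c.
by move=> /(_ [set c k]); apply; exact: discrete_set1.
Qed.

Lemma near_agree c r : \forall z \near c, agree (- r%:Z) r%:Z c z.
Proof.
have FF : ProperFilter (nbhs c) := nbhs_pfilter c.
elim: r => [|r IHr].
  near=> z => k k0; have -> : k = 0 by lia.
  by apply/esym; near: z; exact: near_coord.
near=> z => k kr.
have [->|] := eqVneq k (r.+1%:Z); first by apply/esym; near: z; exact: near_coord.
have [->|] := eqVneq k (- r.+1%:Z).
  by move=> _; apply/esym; near: z; exact: near_coord.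
move=> k1 k2; suff : agree (- r%:Z) r%:Z c z by apply; lia.
by near: z.
Unshelve. all: by end_near. Qed.

(** The supersets of central cylinders around [c] form a filter that converges to [c] in each
    coordinate, hence in the product topology. *)
Lemma nbhs_agree c (U : set (full_shift A)) : nbhs c U ->
  exists r, forall z, agree (- r%:Z) r%:Z c z -> U z.
Proof.
pose F : set_system (full_shift A) :=
  [set U | exists r, forall z, agree (- r%:Z) r%:Z c z -> U z].
have FF : Filter F.
  split; first by exists 0%N.
    move=> P Q [p Pp] [m Qm]; exists (maxn p m) => z cz; split.
      by apply: Pp => k kp; apply: cz; lia.
    by apply: Qm => k kp; apply: cz; lia.
  by move=> P Q PQ [p Pp]; exists p => z /Pp; exact: PQ.
have : F --> c.
  apply/cvg_sup => i V [W] [[D oD <-] Dc DV].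
  exists `|i|%N => z cz; apply: DV => /=.
  by rewrite -(cz i)//; lia.
by move=> /(_ U).
Qed.

Lemma compact_shift_space X : closed X -> compact X.
Proof.
move=> cX.
have /(subclosed_compact cX) : compact [set x : full_shift A | forall i, setT (x i)].
  apply: (@tychonoff int (fun=> discrete_topology A) (fun=> setT)) => i.
  exact/finite_compact/finite_finset.
by apply.
Qed.

(** [phi x 0] is locally constant on [X] because the alphabet is discrete; the near-covering form of
    compactness, with radii tending to infinity, makes the local radii uniform. *)
Lemma uniform_local_code X (phi : full_shift A -> full_shift A) :
  closed X -> {within X, continuous phi} ->
  exists r, forall x z, X x -> X z -> agree (- r%:Z) r%:Z x z ->
    phi x 0 = phi z 0.
Proof.
move=> cX /subspace_continuousP phic.
have /compact_near_coveringP nX := compact_shift_space cX.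
have [|r _ rP] := nX nat \oo (fun r x => X x -> forall z, X z ->
    agree (- r%:Z) r%:Z x z -> phi x 0 = phi z 0).
- move=> c Xc.
  have /nbhs_agree[r rc] : \forall z \near c, X z -> phi z 0 = phi c 0.
    by have /(_ _ (near_coord (phi c) 0)) := phic c Xc.
  have FF : ProperFilter (nbhs c) := nbhs_pfilter c.
  near=> z i => /= Xz y Xy zy.
  have ri : (r <= i)%N by near: i; exact: nbhs_infty_ge.
  have cz : agree (- r%:Z) r%:Z c z by near: z; exact: near_agree.
  rewrite !(rc _) // => k kr.
  by rewrite cz// zy//; lia.
- by exists r => x z Xx Xz xz; exact: (rP r (leqnn r) x Xx Xx z Xz xz).
Unshelve. all: by end_near. Qed.

(** Compactness of [X * X] replaces continuity of the inverse: if [c 0] and [d 0] differ,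
    injectivity gives a coordinate where the images differ, and by locality of [phi] they still
    differ there for all pairs near [(c, d)]. *)
Lemma uniform_local_inverse X (phi : full_shift A -> full_shift A)
    (r : nat) :
  closed X -> {in X &, injective phi} ->
  (forall (k : int) x z, X x -> X z -> agree (- k - r%:Z) (- k + r%:Z) x z ->
     phi x k = phi z k) ->
  exists s : nat, forall x z, X x -> X z ->
    agree (- s%:Z) s%:Z (phi x) (phi z) -> x 0 = z 0.
Proof.
move=> cX phiI phir.
have cXX := compact_setX (compact_shift_space cX) (compact_shift_space cX).
have /compact_near_coveringP nX := cXX.
have [|s _ sP] := nX nat \oo (fun s xz => X xz.1 -> X xz.2 ->
    agree (- s%:Z) s%:Z (phi xz.1) (phi xz.2) -> xz.1 0 = xz.2 0).
- move=> [c d] [/= Xc Xd].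
  have [E|cd] := pselect (c 0 = d 0).
    exists ([set xz | xz.1 0 = c 0 /\ xz.2 0 = d 0], setT).
      split; last exact: filterT.
      exists ([set x | x 0 = c 0], [set x | x 0 = d 0]) => //.
      by split; exact: near_coord.
    by move=> [[x z] i] /= [[-> ->] _].
  have [k ck] : exists k, phi c k <> phi d k.
    apply/existsNP => H; apply: cd; suff -> : c = d by [].
    by apply: phiI; rewrite ?inE//; apply/funext.
  (* Radius [t] covers the source window of coordinate [k], and [t <= i] puts [k] itself inside the
     range where the images are assumed to agree. *)
  pose t := (`|k| + r)%N.
  exists ([set xz | agree (- t%:Z) t%:Z c xz.1 /\ agree (- t%:Z) t%:Z d xz.2],
          [set i | (t <= i)%N]).
    split; last exact: nbhs_infty_ge.
    exists ([set x | agree (- t%:Z) t%:Z c x], [set x | agree (- t%:Z) t%:Z d x]) => //.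
    by split; exact: near_agree.
  move=> [[x z] i] /= [[cx dz] ti] Xx Xz E; exfalso; apply: ck.
  rewrite (phir k c x)//; last by move=> j jk; apply: cx; lia.
  rewrite (phir k d z)//; last by move=> j jk; apply: dz; lia.
  by apply: E; lia.
- by exists s => x z Xx Xz xz; exact: (sP s (leqnn s) (x, z)).
Qed.

End Topology.

(** * Words, translates and invariance under all integer shifts *)

Section Words.
Variable A : finType.
Implicit Types (x z : full_shift A) (X : set (full_shift A)).

Lemma eq_subwordP x z (i : int) (n : nat) :
  subword x i n = subword z i n <-> agree i (i + n%:Z - 1) x z.
Proof.
split=> [E k ki|E]; last first.
  by apply/eq_in_map => k; rewrite mem_iota => kn; apply: E; lia.
have E' : nth (x k) (subword x i n) `|k - i|%N = nth (x k) (subword z i n) `|k - i|%N.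
  by rewrite E.
rewrite !nth_mkseq in E'; [|lia|lia].
have ik : i + `|k - i|%N%:Z = k by lia.
by rewrite ik in E'.
Qed.

Lemma subword_cat x (i : int) (m n : nat) :
  subword x i (m + n) = subword x i m ++ subword x (i + m%:Z) n.
Proof.
rewrite /subword /mkseq iotaD map_cat; congr cat.
rewrite add0n -[in iota m n](addn0 m) iotaDl -map_comp; apply: eq_map => k /=.
by rewrite PoszD addrA.
Qed.

Lemma language_subword X x (i : int) (n : nat) : X x -> language X (subword x i n).
Proof. by move=> Xx; exists x => //; exists i; rewrite size_mkseq. Qed.

Definition translate (k : int) x : full_shift A := fun n => x (n + k).

Lemma subword_translate x (i k : int) (n : nat) :
  subword (translate k x) i n = subword x (i + k) n.
Proof. by apply: eq_map => j; rewrite /translate addrAC. Qed.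

Lemma translateS x (k : int) : translate (k + 1) x = shift_map (translate k x).
Proof. by apply/funext => n; rewrite /translate /shift_map addrA addrAC. Qed.

Lemma translate0 x : translate 0 x = x.
Proof. by apply/funext => n; rewrite /translate addr0. Qed.

Lemma int_shift_ind (P : int -> Prop) :
  P 0 -> (forall k, P k <-> P (k + 1)) -> forall k, P k.
Proof.
move=> P0 PS [n|n].
  by elim: n => // n IHn; have /PS := IHn; rewrite -addn1 PoszD.
rewrite NegzE; elim: n => [|n IHn].
  by apply/PS; have -> : - 1%N%:Z + 1 = 0 :> int by lia.
by apply/PS; have -> : - n.+2%:Z + 1 = - n.+1%:Z :> int by lia.
Qed.

Lemma shift_space_shift X x : shift_space X -> X (shift_map x) <-> X x.
Proof.
move=> [_ XX]; split; last by move=> Xx; rewrite -XX; exists x.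
rewrite -{1}XX => -[y Xy yx]; suff -> : x = y by [].
apply/funext => n; have := congr1 (fun f => f (n - 1)) yx.
by rewrite /shift_map !subrK.
Qed.

Lemma shift_space_translate X x (k : int) :
  shift_space X -> X x -> X (translate k x).
Proof.
move=> sX Xx; move: k; apply: int_shift_ind; first by rewrite translate0.
by move=> k; rewrite translateS shift_space_shift.
Qed.

Lemma language_at X w (i : int) : shift_space X -> language X w ->
  exists2 x, X x & subword x i (size w) = w.
Proof.
move=> sX [x Xx [j xw]]; exists (translate (j - i) x).
  exact: shift_space_translate.
by rewrite subword_translate subrKC.
Qed.

Definition subword_tuple x (i : int) (n : nat) : n.-tuple A :=
  [tuple of mkseq (fun k => x (i + k%:Z)) n].

End Words.

(** * Local rules at every coordinate, with orientation reversed *)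

Section Reversal.
Variables (A : finType) (X : set (full_shift A)).
Variable phi : full_shift A -> full_shift A.
Hypothesis shX : shift_space X.
Hypothesis phi_shift : forall x, X x -> shift_map_inv (phi x) = phi (shift_map x).

Lemma phi_translate x (k : int) : X x -> phi (translate k x) = translate (- k) (phi x).
Proof.
move=> Xx; move: k; apply: int_shift_ind; first by rewrite oppr0 !translate0.
move=> k; rewrite translateS -phi_shift; last exact: shift_space_translate.
have -> : translate (- (k + 1)) (phi x) = shift_map_inv (translate (- k) (phi x)).
  by apply/funext => n; rewrite /translate /shift_map_inv opprD addrA addrAC.
split=> [-> //|E]; apply/funext => n.
by have := congr1 (fun f => f (n + 1)) E; rewrite /shift_map_inv !addrK.
Qed.

(** Translating the source by [- k] brings coordinate [k] of the image to 0, so the window is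
    centred at [- k]. *)
Lemma local_code r :
  (forall x z, X x -> X z -> agree (- r%:Z) r%:Z x z -> phi x 0 = phi z 0) ->
  forall (k : int) x z, X x -> X z -> agree (- k - r%:Z) (- k + r%:Z) x z ->
    phi x k = phi z k.
Proof.
move=> phir k x z Xx Xz xz.
have E y : X y -> phi y k = phi (translate (- k) y) 0.
  by move=> Xy; rewrite phi_translate// /translate add0r opprK.
rewrite !E//; apply: phir; try exact: shift_space_translate.
by move=> j jr; rewrite /translate; apply: xz; lia.
Qed.

Lemma local_inverse r :
  (forall x z, X x -> X z -> agree (- r%:Z) r%:Z (phi x) (phi z) -> x 0 = z 0) ->
  forall (k : int) x z, X x -> X z ->
    agree (- k - r%:Z) (- k + r%:Z) (phi x) (phi z) -> x k = z k.
Proof.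
move=> phir k x z Xx Xz xz.
have E y : y k = translate k y 0 by rewrite /translate add0r.
rewrite !E; apply: phir; try exact: shift_space_translate.
by move=> j jr; rewrite !phi_translate// /translate; apply: xz; lia.
Qed.

End Reversal.

(** * Counting predecessor sets by follower sets *)

Lemma card_fset_set_le (T : choiceType) (I : finType) (f : I -> T) (S : set T) :
  S `<=` range f -> (#|` fset_set S| <= #|I|)%N.
Proof.
move=> Sf.
have fS : finite_set (range f) by exact/finite_image/finite_finset.
apply: (@leq_trans #|` [fset f i | i in I]%fset|); last first.
  by rewrite (leq_trans (leq_imfset_card _ _ _))// cardE.
apply: fsubset_leq_card; apply/fsubsetP => t.
rewrite in_fset_set; last exact: sub_finite_set fS.
by rewrite inE => /Sf[i _ <-]; apply/imfsetP; exists i.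
Qed.

Section Count.
Variables (A : finType) (X : set (full_shift A)).
Variable phi : full_shift A -> full_shift A.
Variable r : nat.
Hypotheses (shX : shift_space X) (phiX : set_bij X X phi).
Hypothesis phi_local : forall (k : int) x z, X x -> X z ->
  agree (- k - r%:Z) (- k + r%:Z) x z -> phi x k = phi z k.
Hypothesis phi_inv_local : forall (k : int) x z, X x -> X z ->
  agree (- k - r%:Z) (- k + r%:Z) (phi x) (phi z) -> x k = z k.

(* Points with the same image on [0, n) agree away from the two ends of their
   source window [1 - n - r, r], so lctx and rctx pin down the whole window. *)
Let lctx (n : nat) (x : full_shift A) := subword_tuple x (1 - n%:Z - r%:Z) r.*2.
Let rctx (x : full_shift A) := subword_tuple x (1 - r%:Z) r.*2.
Let source (n : nat) (x : full_shift A) := subword x (1 - n%:Z - r%:Z) (n + r.*2).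

Lemma source_determined n x z : X x -> X z ->
  subword (phi x) 0 n = subword (phi z) 0 n -> lctx n x = lctx n z ->
  rctx x = rctx z -> source n x = source n z.
Proof.
move=> Xx Xz /eq_subwordP E /(congr1 val)/eq_subwordP L /(congr1 val)/eq_subwordP C.
apply/eq_subwordP => k kn.
have [kl|kl] := leP k (- n%:Z + r%:Z); first by apply: L; lia.
have [kr|kr] := leP (1 - r%:Z) k; first by apply: C; lia.
(* Between the two contexts, the image window [[- k - r, - k + r]] lies inside [[0, n)]. *)
by apply: phi_inv_local => // j jk; apply: E; lia.
Qed.

(* Every predecessor of a word is read off from some right end of a source word
   together with the follower set of that source word. *)
Let extensions (b : seq A) (F : set (seq A)) : set (seq A) :=
  [set s | exists x, [/\ X x, subword x (1 - r%:Z) r.*2 = b,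
    F (subword x (1 + r%:Z) (size s)) &
    subword (phi x) (- (size s)%:Z) (size s) = s]].

(** Reversal turns a left extension of [v] into a right extension of a source word. Conversely, a
    source of [v] is spliced with a continuation seen in another point [x']: the common 2r letters
    [b] are all that [phi] needs across the seam. *)
Lemma predecessor_setE (v : seq A) :
  predecessor_set X v = [set s | exists x, [/\ X x,
    subword (phi x) 0 (size v) = v &
    extensions (rctx x) (follower_set X (source (size v) x)) s]].
Proof.
have [phiXX phi_inj phi_surj] := phiX.
pose n := size v.
rewrite -/n; apply/seteqP; split => s /=.
  move=> [_ /(language_at (- (size s)%:Z) shX)[y Xy]].
  rewrite size_cat subword_cat addNr => /eqP.
  rewrite eqseq_cat ?size_mkseq// => /andP[/eqP ys /eqP yv].
  have [x Xx xy] := phi_surj y Xy; exists x; rewrite xy; split => //.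
  exists x; rewrite xy; split => //; split; first exact: language_subword.
  have -> : 1 + r%:Z = 1 - n%:Z - r%:Z + (n + r.*2)%N%:Z by lia.
  by rewrite -subword_cat; exact: language_subword.
move=> [x [Xx xv [x' [Xx' x'b [_ /(language_at (1 - n%:Z - r%:Z) shX)[z Xz zp]] x's]]]].
have ss : size (source n x) = (n + r.*2)%N by rewrite size_mkseq.
move: zp; rewrite size_cat ss size_mkseq subword_cat => /eqP.
rewrite eqseq_cat ?ss ?size_mkseq// => /andP[/eqP/eq_subwordP zx /eqP].
have -> : 1 - n%:Z - r%:Z + (n + r.*2)%N%:Z = 1 + r%:Z by lia.
move=> /eq_subwordP zx'; move/eq_subwordP : x'b => x'b.
(* The letters of [s] depend on [[1 - r, size s + r]], where [z] agrees with [x']: through [b] up to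
   [r], through the continuation beyond. *)
have zs : subword (phi z) (- (size s)%:Z) (size s) = s.
  rewrite -[RHS]x's; apply/eq_subwordP => k ks.
  apply: phi_local => // j jk.
  have [jr|jr] := leP j r%:Z; last by apply: zx'; lia.
  rewrite x'b; last by lia.
  by apply: zx; lia.
have zv : subword (phi z) 0 n = v.
  rewrite -[RHS]xv; apply/eq_subwordP => k kn.
  by apply: phi_local => // j jk; apply: zx; lia.
have Xphiz : X (phi z) by exact: phiXX.
split; first by rewrite -zs; exact: language_subword.
by rewrite -{1}zs -zv -[X in subword _ X n](addNr (size s)%:Z) -subword_cat;
  exact: language_subword.
Qed.

(** By [source_determined], the union in [predecessor_setE] can be indexed by the pairs of contexts
    [J], so a predecessor set is coded by a function from [J] to [T]. *)
Lemma card_predecessor_sets (n : nat) :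
  (#|` fset_set (predecessor_sets X n)| <=
   (#|A| ^ r.*2 * #|` fset_set (follower_sets X (n + r.*2))|)
     ^ (#|A| ^ r.*2 * #|A| ^ r.*2))%N.
Proof.
pose Fs := fset_set (follower_sets X (n + r.*2)).
pose J := ((r.*2).-tuple A * (r.*2).-tuple A)%type.
pose T := ((r.*2).-tuple A * Fs)%type.
pose f (e : {ffun J -> T}) : set (seq A) :=
  [set s | exists j, extensions (e j).1 (val (e j).2) s].
have -> : ((#|A| ^ r.*2 * #|` Fs|) ^ (#|A| ^ r.*2 * #|A| ^ r.*2))%N =
    #|{ffun J -> T}|.
  by rewrite card_ffun !card_prod !card_tuple cardfE.
apply: (@card_fset_set_le _ _ f) => _ [v [Lv sv] <-].
have [phiXX phi_inj phi_surj] := phiX.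
have Fsource x : X x -> follower_set X (source n x) \in Fs.
  move=> Xx; rewrite in_fset_set ?inE; last exact: finite_follower_sets.
  exists (source n x) => //; split; last by rewrite size_mkseq.
  exact: language_subword.
have [y Xy yv] := language_at 0 shX Lv.
have [x0 Xx0 x0y] := phi_surj y Xy.
(* The first clause keeps spurious extensions out of the union; the second ensures that no source is
   missed. *)
have /choice[e eP] : forall j : J, exists t : T,
    (exists x, [/\ X x, subword (phi x) 0 n = v,
      t.1 = rctx x & val t.2 = follower_set X (source n x)]) /\
    (forall x, X x -> subword (phi x) 0 n = v -> j = (lctx n x, rctx x) ->
      t.1 = rctx x /\ val t.2 = follower_set X (source n x)).
  move=> j.
  have [[x [Xx xv jx]]|nx] := pselect (exists x, [/\ X x,
      subword (phi x) 0 n = v & j = (lctx n x, rctx x)]).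
    exists (rctx x, [` Fsource x Xx]%fset); split; first by exists x.
    move=> z Xz zv; rewrite jx => /pair_equal_spec[lE rE]; split => //=.
    by congr (follower_set X _); apply: source_determined; rewrite ?xv.
  (* A pair of contexts that no source realizes repeats the data of the fixed source [x0], which
     leaves the union unchanged. *)
  exists (rctx x0, [` Fsource x0 Xx0]%fset); split.
    by exists x0; split => //; rewrite x0y -sv.
  by move=> z Xz zv jz; exfalso; apply: nx; exists z.
exists [ffun j => e j] => //; rewrite predecessor_setE sv.
apply/seteqP; split => s /=.
  move=> [j]; rewrite ffunE; have [[x [Xx xv -> ->]] _] := eP j.
  by exists x.
move=> [x [Xx xv xs]]; exists (lctx n x, rctx x); rewrite ffunE.
by have [_ /(_ x Xx xv erefl)[-> ->]] := eP (lctx n x, rctx x).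
Qed.

End Count.

(** * Comparison of exponential growth rates *)

Section ExponentialGrowth.
Variable R : realType.
Implicit Types u : nat -> R.

Lemma limn_esup_lt u (d : R) : (limn_esup (fun n => (u n)%:E) < d%:E)%E ->
  \forall n \near \oo, u n < d.
Proof.
move=> /ereal_inf_lt[_ [V [N _ NV] <-]] Vd.
exists N => // n Nn; rewrite /= -lte_fin; apply: le_lt_trans Vd.
by apply: ereal_sup_ubound; exists n => //; exact: NV.
Qed.

Lemma limn_esup_le u (d : R) : (\forall n \near \oo, u n <= d) ->
  (limn_esup (fun n => (u n)%:E) <= d%:E)%E.
Proof.
move=> ud; apply: ge_ereal_inf; exists (ereal_sup [set (u n)%:E | n in [set n | u n <= d]]).
  by exists [set n | u n <= d].
by apply: ge_ereal_sup => _ [n nd <-]; rewrite lee_fin.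
Qed.

Lemma growth_rate_le0 (a b : nat -> nat) (C K m : nat) :
  (0 < C)%N -> (forall n, (0 < a n)%N) ->
  (forall n, (b n <= (C * a (n + m)) ^ K)%N) ->
  limn_esup (fun n => (n%:R^-1 * ln (a n)%:R : R)%:E) = 0%E ->
  (limn_esup (fun n => (n%:R^-1 * ln (b n)%:R : R)%:E) <= 0)%E.
Proof.
move=> C0 a0 ba alim; apply/lee_addgt0Pr => e e0; rewrite add0e.
have lnC : 0 <= ln (C%:R : R) by rewrite ln_ge0// ler1n.
(* With [n + m <= 2 * n], this rate for [a] contributes at most [n * e / 2] after multiplication by
   [K]; the summand 4 keeps the divisor positive when [K] is 0. *)
have d0 : 0 < e / (4 * K%:R + 4) by rewrite divr_gt0// ltr_wpDl.
apply: limn_esup_le.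
have [N _ aN] : \forall n \near \oo, n%:R^-1 * ln (a n)%:R < e / (4 * K%:R + 4).
  by apply: limn_esup_lt; rewrite alim lte_fin.
(* Beyond [M] the constant term [K * ln C] is at most [n * e / 2], the other half of the budget. *)
pose M := (Num.truncn (2 * K%:R * ln (C%:R : R) / e)).+1.
exists (maxn N (maxn m M)) => // n /=; rewrite !geq_max => /and3P[Nn mn Mn].
have n0 : 0 < n%:R :> R by rewrite ltr0n; apply: leq_trans Mn.
have [b0|b0] := posnP (b n).
  (* Here [ln 0] takes its default value 0. *)
  by rewrite b0 ln0// mulr0 ltW.
have Mn' : 2 * K%:R * ln (C%:R : R) <= n%:R * e.
  rewrite -ler_pdivrMr// ltW//; apply: (lt_le_trans (truncnS_gt _)).
  by rewrite ler_nat.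
have an : ln (a (n + m)%N)%:R <= (n%:R + n%:R) * (e / (4 * K%:R + 4)).
  have nm : 0 < (n + m)%:R :> R by rewrite ltr0n addn_gt0 -(ltr0n R) n0.
  have := aN (n + m)%N (leq_trans Nn (leq_addr _ _)).
  rewrite /= mulrC ltr_pdivrMr// mulrC => /ltW/le_trans; apply.
  by rewrite natrD ler_wpM2r ?(ltW d0)// lerD2l ler_nat.
have lnb : ln (b n)%:R <= K%:R * (ln (C%:R : R) + ln (a (n + m)%N)%:R).
  have Ca : 0 < (C * a (n + m))%:R :> R by rewrite ltr0n muln_gt0 C0 a0.
  rewrite -lnM ?posrE ?ltr0n// -natrM mulr_natl -lnXn//.
  by rewrite ler_ln ?posrE ?ltr0n// ?exprn_gt0// -natrX ler_nat.
rewrite mulrC ler_pdivrMr//; apply: (le_trans lnb).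
have Kd : K%:R * (e / (4 * K%:R + 4)) <= e / 4.
  rewrite mulrA ler_pdivrMr ?ltr_wpDl//.
  have K0 : 0 <= K%:R :> R by [].
  by nra.
have Kan := ler_wpM2l (ler0n R K) an.
have nKd := ler_wpM2l (ltW n0) Kd.
nra.
Qed.

End ExponentialGrowth.

Theorem mainTheorem7 (R : realType) (A : finType) (X : set (full_shift A))
    (X0 : X !=set0) (shX : shift_space X)
    (hF : follower_entropy R X = 0%E) (hP : (0 < predecessor_entropy R X)%E) :
  ~ topologically_conjugate X (@shift_map A) X (@shift_map_inv A).
Proof.
move=> [phi [phic phiX phi_shift]].
have [cX _] := shX; have [_ phi_inj _] := phiX; have [x Xx] := X0.
have [r1 r1P] := uniform_local_code cX phic.
have [r2 r2P] := uniform_local_inverse cX phi_inj (local_code shX phi_shift r1P).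
(* Both local rules survive enlarging the window, so one radius serves for both. *)
pose r := maxn r1 r2.
have codeP : forall (k : int) (y z : full_shift A), X y -> X z ->
    agree (- k - r%:Z) (- k + r%:Z) y z -> phi y k = phi z k.
  apply: (local_code shX phi_shift) => y z Xy Xz yz.
  by apply: r1P => // k kr; apply: yz; lia.
have inverseP : forall (k : int) (y z : full_shift A), X y -> X z ->
    agree (- k - r%:Z) (- k + r%:Z) (phi y) (phi z) -> y k = z k.
  apply: (local_inverse shX phi_shift) => y z Xy Xz yz.
  by apply: r2P => // k kr; apply: yz; lia.
have Pn := card_predecessor_sets shX phiX codeP inverseP.
suff : (predecessor_entropy R X <= 0)%E by rewrite leNgt hP.
(* The point [x] supplies a letter, so the constant [#|A| ^ r.*2] is positive, and a word of every
   length, so there is always a follower set. *)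
apply: (growth_rate_le0 _ _ Pn hF) => [|n].
  by rewrite expn_gt0; apply/orP; left; apply/card_gt0P; exists (x 0).
rewrite cardfs_gt0; apply/fset0Pn; exists (follower_set X (subword x 0 n)).
rewrite in_fset_set ?inE; last exact: finite_follower_sets.
exists (subword x 0 n) => //; split; last by rewrite size_mkseq.
exact: language_subword.
Qed.
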